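(* Let $n$ be a positive integer and $\zeta_n$ a primitive $n$-th root of unity. For integers $k,l$ with $k\geq l\geq 0$, we have $$G_n^t(k,l;\zeta_n)=\sum_{m=0}^k\frac{(-1)^m}{n^{m+1}}\sum\prod_{a=0}^m\binom{n}{j_a+1}\,(1-t)^{i_0}(-t)^{l-i_0},$$ where the inner sum runs over all integers $i_0,\ldots,i_m,j_0,\ldots,j_m$ satisfying $i_0+\cdots+i_m=l$, $j_0+\cdots+j_m=k$, $0\leq i_a\leq j_a\leq n-1$ for $a=0,\ldots,m$, and $j_1,\ldots,j_m\geq 1$; and $$G_n^t(k,l;\zeta_n)=-\sum_{m=0}^k\frac{1}{n^{m+1}}\sum\left(\prod_{a=0}^m\binom{n}{j_a+1}\overline{z}_n(l_a;\zeta_n)\right)(1-t)^{i_0}(-t)^{l-i_0},$$ where the inner sum runs over all integers $i_0,\ldots,i_m,j_0,\ldots,j_m,l_0,\ldots,l_m$ satisfying $i_0+\cdots+i_m=l$, $l_0+\cdots+l_m+j_0+\cdots+j_m=k$, $0\leq i_0\leq j_0\leq n-1$, $1\leq i_a\leq j_a\leq n-1$ for $a=1,\ldots,m$, and $l_0,\ldots,l_m\geq 0$. Here the convention $\overline{z}_n(0;\zeta_n)=-1$ is used.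
   Context: $\mathbb{N}$ is the set of positive integers and $t$ is a formal parameter. For a multi-index $\mathbf{k}=(k_1,\ldots,k_l)\in\mathbb{N}^l$ define the weight $\mathrm{wt}(\mathbf{k})=k_1+\cdots+k_l$ and the depth $\mathrm{dep}(\mathbf{k})=l$. Let $q$ be a complex number with $q^m\ne1$ for every positive integer $m<n$ (e.g. $q=\zeta_n$). For $\mathbf{k}\in\mathbb{N}^l$ with $l\ge 1$, $$\overline{z}_n(\mathbf{k};q)=\sum_{n>m_1>\cdots>m_l>0}\frac{q^{(k_1-1)m_1+\cdots+(k_l-1)m_l}}{(1-q^{m_1})^{k_1}\cdots(1-q^{m_l})^{k_l}},$$ and its interpolated version is $$\overline{z}_n^t(\mathbf{k};q)=\sum_{\mathbf{p}}\overline{z}_n(\mathbf{p};q)\,t^{l-\mathrm{dep}(\mathbf{p})},$$ where the sum runs over all $3^{l-1}$ ways of forming $\mathbf{p}=(k_1\Box\cdots\Box k_l)$ by filling each $\Box$ with '','' (comma), ''$+$'' or ''$-1+$''. For nonnegative integers $k,l$, $G_n^t(k,l;q)$ is the sum of $\overline{z}_n^t(\mathbf{k};q)$ over all multi-indices $\mathbf{k}$ of weight $k$ and depth $l$; it is $0$ when there are no such multi-indices, except that $G_n^t(0,0;q)=1$. *)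

(* Defs.v *)
From HB Require Import structures.
From mathcomp Require Import all_boot all_order all_algebra.
From mathcomp Require Import reals.
From mathcomp.real_closed Require Import complex.

Set Implicit Arguments.
Unset Strict Implicit.
Unset Printing Implicit Defensive.

Import GRing.Theory.
Local Open Scope ring_scope.

(* Multi-indices (k_1, ..., k_l) are sequences of positive natural numbers.
   The parameter t is formal: it is the variable 'X of {poly F}. *)

Section Values.
Variable F : fieldType.

(* The bound variable m lists (m_1, ..., m_l), with n > m_1 > ... > m_l > 0;
   the value at the empty multi-index is 1.  The predecessor (k_i).-1 is
   truncated, so the definition is only meant for positive k_i; see zbar1 for
   the value at the index 0. *)
Definition zbar (n : nat) (q : F) (k : seq nat) : F :=
  \sum_(m : (size k).-tuple 'I_n
          | sorted gtn (map val m) && all (leq 1) (map val m))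
    q ^+ (\sum_(i < size k) (nth 0%N k i).-1 * tnth m i)%N
      / \prod_(i < size k) (1 - q ^+ tnth m i) ^+ nth 0%N k i.

(* Depth one, extended to the index 0 by the convention that the value
   there is -1. *)
Definition zbar1 (n : nat) (q : F) (k : nat) : F :=
  if k == 0%N then -1 else zbar n q [:: k].

End Values.

(* The three ways to fill a box: a comma, "+" or "-1+". *)
Inductive filling := Comma | Plus | MinusOnePlus.

Definition filling_code (b : filling) : option bool :=
  match b with
  | Comma => None
  | Plus => Some true
  | MinusOnePlus => Some false
  end.

Definition filling_decode (c : option bool) : filling :=
  match c with
  | None => Comma
  | Some true => Plus
  | Some false => MinusOnePlus
  end.

Lemma filling_codeK : cancel filling_code filling_decode.
Proof. by case. Qed.

HB.instance Definition _ := Finite.copy filling (can_type filling_codeK).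

(* merge_from a bs ks is a b_1 k_1 b_2 k_2 ..., where a is the entry under
   construction. *)
Fixpoint merge_from (a : nat) (bs : seq filling) (ks : seq nat) : seq nat :=
  match bs, ks with
  | Comma :: bs', k :: ks' => a :: merge_from k bs' ks'
  | Plus :: bs', k :: ks' => merge_from (a + k)%N bs' ks'
  | MinusOnePlus :: bs', k :: ks' => merge_from (a - 1 + k)%N bs' ks'
  | _, _ => [:: a]
  end.

Definition merge_index (ks : seq nat) (bs : seq filling) : seq nat :=
  if ks is k :: ks' then merge_from k bs ks' else [::].

Section Interpolated.
Variable F : fieldType.

Definition zbart (n : nat) (q : F) (k : seq nat) : {poly F} :=
  \sum_(b : (size k).-1.-tuple filling)
    zbar n q (merge_index k b) *: 'X^(size k - size (merge_index k b)).

(* The entries of a multi-index of weight k are at most k, so that the sum can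
   range over tuples of ordinals. *)
Definition Gzt (n k l : nat) (q : F) : {poly F} :=
  if (k == 0%N) && (l == 0%N) then 1 else
  \sum_(s : l.-tuple 'I_k.+1
          | all (leq 1) (map val s) && (sumn (map val s) == k))
    zbart n q (map val s).

End Interpolated.

(* Main.v *)
(* Write u = q^m and f(k) = u^(k-1)/(1-u)^k.  Since f(a) f(b) = f(a+b) + f(a+b-1),
   the fillings "+" and "-1+" together turn the interpolated values into sums over
   weakly decreasing chains, with a factor t for every equality.  The generating
   function of the G_n^t(k,l) in X (weight) and Y (depth) is therefore
     prod_(0<m<n) (1 - u(1+X) + (1-t)XY) / (1 - u(1+X) - tXY).
   For u running over the nontrivial n-th roots of unity, a^n - b^n = prod (a - u b)
   turns it into P(1-t)/P(-t), where P(c) = sum_(i<=j<n) binom(n,j+1) c^i Y^i X^j.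
   The two formulas expand 1/P(-t) as a geometric series around the term n (j = 0)
   and around the terms with i = 0; the inverse of the latter sum is -1/n times the
   generating function of the depth-one values, by logarithmic differentiation. *)
Require Import Defs.
From mathcomp Require Import all_boot all_order all_algebra.
From mathcomp Require Import reals.
From mathcomp.real_closed Require Import complex.
From mathcomp Require Import ring.

Set Implicit Arguments.
Unset Strict Implicit.
Unset Printing Implicit Defensive.

Import GRing.Theory.
Local Open Scope ring_scope.

(** * Sums over tuples and fillings *)

Lemma big_tuple_cons (V : nmodType) (T : finType) (l : nat)
    (P : pred (seq T)) (f : seq T -> V) :
  \sum_(s : l.+1.-tuple T | P s) f s =
    \sum_(x : T) \sum_(s : l.-tuple T | P (x :: s)) f (x :: s).
Proof.
rewrite pair_big_dep /=.
rewrite (reindex (fun p : T * l.-tuple T => [tuple of p.1 :: p.2])) //=.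
exists (fun s : l.+1.-tuple T => (thead s, [tuple of behead s])).
  by move=> [x s] _; congr pair; apply: val_inj.
by move=> s _; apply: val_inj; rewrite /= [in RHS](tuple_eta s).
Qed.

Lemma big_tuple0 (V : nmodType) (T : finType) (P : pred (seq T)) (f : seq T -> V) :
  \sum_(s : 0.-tuple T | P s) f s = if P [::] then f [::] else 0.
Proof.
rewrite big_mkcond (bigD1 [tuple]) //= big1 ?addr0 // => s.
by case/eqP; rewrite (tuple0 s).
Qed.

Lemma big_tuple_pos (V : nmodType) (K l : nat) (f : seq nat -> V) :
  \sum_(s : l.+1.-tuple 'I_K | all (leq 1) (map val s)) f (map val s) =
  \sum_(k < K | (0 < k)%N) \sum_(s : l.-tuple 'I_K | all (leq 1) (map val s))
     f (val k :: map val s).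
Proof.
rewrite (@big_tuple_cons _ _ _ (fun s => all (leq 1) (map val s))
  (fun s => f (map val s))) /= [RHS]big_mkcond.
by apply: eq_bigr => k _; case: ifP => // k0; rewrite big_pred0.
Qed.

Lemma sumn_pos (s : seq nat) : all (leq 1) s -> (size s <= sumn s)%N.
Proof. by elim: s => //= a s IH /andP[a0 /IH IHs]; rewrite -add1n leq_add. Qed.

Lemma big_filling (V : nmodType) (f : filling -> V) :
  \sum_b f b = f Comma + (f Plus + f MinusOnePlus).
Proof.
rewrite (bigD1 Comma) //= (bigD1 Plus) //= (bigD1 MinusOnePlus) //=.
by rewrite big_pred0 ?addr0 //; case.
Qed.

(** * Interpolated values as sums over weakly decreasing chains *)

Section Nested.
Variables (F : fieldType) (q : F).

Definition zterm (m k : nat) : F := q ^+ (k.-1 * m) / (1 - q ^+ m) ^+ k.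

(** With u = q^m and common denominator (1-u)^(a+k), the numerators add up to u^(a+k-1) + u^(a+k-2)
    (1-u) = u^(a+k-2). *)
Lemma zterm_merge (m a k : nat) : 1 - q ^+ m != 0 -> (0 < a)%N -> (0 < k)%N ->
  zterm m (a + k) + zterm m (a - 1 + k) = zterm m a * zterm m k.
Proof.
case: a => // a; case: k => // k u1 _ _.
rewrite /zterm subn1 !addnS addSn /= ![(_ * m)%N]mulnC !exprM !exprS !exprD.
by field; rewrite u1 !expf_neq0.
Qed.

Fixpoint nested (ks : seq nat) (N : nat) : F :=
  if ks is k :: ks' then \sum_(1 <= m < N) zterm m k * nested ks' m else 1.

Lemma zbarE (n : nat) (ks : seq nat) : zbar n q ks = nested ks n.
Proof.
pose g (ks m : seq nat) := \prod_(i < size ks) zterm (nth 0%N m i) (nth 0%N ks i).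
transitivity (\sum_(m : (size ks).-tuple 'I_n
   | path gtn n (map val m) && all (leq 1) (map val m)) g ks (map val m)).
  apply: eq_big => [m|m _].
    case: m => [[|x m] sm] //=; by rewrite ltn_ord.
  rewrite /g /zterm prodf_div prodrXr; congr (_ / _).
    congr (_ ^+ _); apply: eq_bigr => i _.
    by rewrite (tnth_nth (tnth m i)) (nth_map (tnth m i)) ?size_tuple.
  apply: eq_bigr => i _; rewrite (tnth_nth (tnth m i)).
  by rewrite (nth_map (tnth m i)) ?size_tuple.
(* The bound on the chain becomes a free N <= n while the index type stays ['I_n]: after m_1 is
   peeled off, the rest is bounded by m_1. *)
suff gen N : (N <= n)%N ->
    \sum_(m : (size ks).-tuple 'I_n
      | path gtn N (map val m) && all (leq 1) (map val m)) g ks (map val m)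
    = nested ks N by exact: gen.
elim: ks N => [|k ks IH] N leN.
  rewrite (big_tuple0 (fun m => path gtn N (map val m) && all (leq 1) (map val m))
     (fun m => g [::] (map val m))) /= /g big_ord0 //.
rewrite (@big_tuple_cons _ _ _
     (fun m => path gtn N (map val m) && all (leq 1) (map val m))
     (fun m => g (k :: ks) (map val m))) /=.
transitivity (\sum_(m < n | (0 < m < N)%N) zterm m k * nested ks m).
  rewrite [RHS]big_mkcond; apply: eq_bigr => m _; case: ifP => mN; last first.
    rewrite big_pred0 // => s; apply: contraFF mN.
    by case/and3P=> /andP[-> _] -> _.
  case/andP: mN => m0 mN.
  rewrite -(IH _ (ltnW (ltn_ord m))) mulr_sumr.
  apply: eq_big => [s|s _].
    by rewrite mN m0.
  by rewrite /g big_ord_recl /=.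
rewrite big_geq_mkord (big_ord_widen_cond n (fun m => 1 <= m)%N
  (fun m => zterm m k * nested ks m)) //.
Qed.

(* S(k_1, ..., k_l; m): sum over m >= m_1 >= ... >= m_l > 0, with a factor t
   for every equality in the chain. *)
Fixpoint wnested (ks : seq nat) (m : nat) : {poly F} :=
  if ks is k :: ks' then
    \sum_(1 <= m' < m) zterm m' k *: wnested ks' m'
      + zterm m k *: ('X * wnested ks' m)
  else 1.

Lemma size_merge_from (bs : seq filling) (ks : seq nat) (a : nat) :
  (size (merge_from a bs ks) <= (size ks).+1)%N.
Proof.
elim: bs ks a => [|b bs IH] [|k ks] a //=; case: b => //=;
  by rewrite ?ltnS ?IH // ltnW // ltnS IH.
Qed.

(** Induction on the boxes from the left: a comma makes the next variable strictly smaller, while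
    the other two fillings add up, by [zterm_merge], to the case of equality with its factor t. *)
Lemma zbart_wnested (n k : nat) (ks : seq nat) :
    (forall m, (0 < m < n)%N -> 1 - q ^+ m != 0) -> all (leq 1) (k :: ks) ->
  zbart n q (k :: ks) = \sum_(1 <= m < n) zterm m k *: wnested ks m.
Proof.
move=> q1; rewrite /zbart /=; under eq_bigr do rewrite zbarE.
(* Only the summation bounds become N <= n, since a comma leaves a sum below m; the nonvanishing
   hypothesis keeps n. *)
have: (n <= n)%N by []; move: {1 3 4}n.
elim: ks k => [|k ks IH] a N leN.
  move=> _ /=; rewrite (big_tuple0 predT (fun b => nested (merge_from a b [::]) N *:
     'X^(1 - size (merge_from a b [::])))) /=.
  rewrite subnn expr0 scaler_suml; apply: eq_bigr => m _.
  by rewrite /= mulr1.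
move=> /= /and3P[a0 k0 ks0].
rewrite (@big_tuple_cons _ _ _ predT (fun b => nested (merge_from a b (k :: ks)) N *:
     'X^((size ks).+2 - size (merge_from a b (k :: ks))))) /=.
rewrite big_filling /=.
(* Either filling without a comma loses one entry, hence the extra ['X]; [c] stands for a + k or a -
   1 + k. *)
have plus c : (0 < c)%N -> \sum_(s : (size ks).-tuple filling)
     nested (merge_from c s ks) N *:
        'X^((size ks).+2 - size (merge_from c s ks)) =
   \sum_(1 <= m < N) zterm m c *: ('X * wnested ks m).
  move=> c0; under eq_bigr do rewrite (subSn (size_merge_from _ _ _)) exprS scalerAr.
  rewrite -mulr_sumr IH ?c0 // mulr_sumr; apply: eq_bigr => m _.
  by rewrite scalerAr.
rewrite !plus ?addn_gt0 ?k0 ?orbT //.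
have -> : \sum_(s : (size ks).-tuple filling)
    (\sum_(1 <= m < N) zterm m a * nested (merge_from k s ks) m) *:
       'X^((size ks).+2 - (size (merge_from k s ks)).+1) =
   \sum_(1 <= m < N) zterm m a *: \sum_(1 <= m' < m) zterm m' k *: wnested ks m'.
  under eq_bigr do rewrite scaler_suml.
  rewrite exchange_big; apply: eq_big_nat => m /andP[_ mN] /=.
  rewrite -IH ?k0 //; last by rewrite (leq_trans (ltnW mN)).
  rewrite scaler_sumr; apply: eq_bigr => s _.
  by rewrite subSS scalerA.
rewrite -!big_split /=; apply: eq_big_nat => m /andP[m0 mN].
rewrite -scalerDl zterm_merge ?scalerDr ?scalerA //.
by rewrite q1 // m0 (leq_trans mN).
Qed.

End Nested.

(** * Congruences modulo a power of the weight variable *)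

Section Truncation.
Variables (B : comNzRingType) (N : nat).
Implicit Types p q : {poly B}.

(** Replaces equality of power series in X; with an explicit cofactor, each closure property is a
    ring identity. *)
Definition eqmodXn p q := exists r, p = q + r * 'X^N.

Lemma eqmodXn_refl p : eqmodXn p p.
Proof. by exists 0; rewrite mul0r addr0. Qed.

Lemma eqmodXn_sym p q : eqmodXn p q -> eqmodXn q p.
Proof. by case=> r ->; exists (- r); ring. Qed.

Lemma eqmodXn_trans q p r : eqmodXn p q -> eqmodXn q r -> eqmodXn p r.
Proof. by move=> [s ->] [s' ->]; exists (s + s'); ring. Qed.

Lemma eqmodXnD p p' q q' :
  eqmodXn p p' -> eqmodXn q q' -> eqmodXn (p + q) (p' + q').
Proof. by move=> [s ->] [s' ->]; exists (s + s'); ring. Qed.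

Lemma eqmodXnM p p' q q' :
  eqmodXn p p' -> eqmodXn q q' -> eqmodXn (p * q) (p' * q').
Proof.
by move=> [s ->] [s' ->]; exists (s * q' + p' * s' + s * s' * 'X^N); ring.
Qed.

Lemma eqmodXn_coef p q i : (i < N)%N -> eqmodXn p q -> p`_i = q`_i.
Proof. by move=> iN [r ->]; rewrite coefD coefMXn iN addr0. Qed.

(** Since v inverts p0, 1/(p0 + p1) is the sum of (-1)^m v^(m+1) p1^m; X divides p1, so the terms
    with m >= N vanish modulo X^N. *)
Lemma geometric_inverse (v p0 p1 r : {poly B}) :
    eqmodXn (v * p0) 1 -> p1 = r * 'X ->
  eqmodXn ((\sum_(0 <= m < N) (-1) ^+ m * (v ^+ m.+1 * p1 ^+ m)) * (p0 + p1)) 1.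
Proof.
move=> vp0 ->; set p := r * 'X.
pose g := \sum_(0 <= m < N) (-1) ^+ m * (v ^+ m * p ^+ m).
have E1 : \sum_(0 <= m < N) (-1) ^+ m * (v ^+ m.+1 * p ^+ m) = v * g.
  by rewrite mulr_sumr; apply: eq_bigr => m _; rewrite exprS; ring.
case: vp0 => s vp0.
have E2 : g * (1 + v * p) = 1 - (- (v * p)) ^+ N.
  rewrite /g {E1}; elim: N => [|M IH]; first by rewrite big_geq // expr0; ring.
  rewrite big_nat_recr //= mulrDl IH !exprS -[- (v * p)]mulN1r !exprMn.
  by ring.
rewrite E1; exists (g * s - (- (v * r)) ^+ N).
have -> : v * g * (p0 + p) = g * (v * p0) + g * (v * p) by ring.
rewrite vp0.
have -> : g * (1 + s * 'X^N) + g * (v * p) = g * (1 + v * p) + g * s * 'X^N by ring.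
rewrite E2 /p mulrA -mulNr exprMn; ring.
Qed.

Lemma eqmodXn_divr (c p p' u : {poly B}) :
  eqmodXn (c * p) p' -> eqmodXn (u * p) 1 -> eqmodXn c (p' * u).
Proof.
move=> cp up; apply: (@eqmodXn_trans (c * p * u)); last first.
  exact: eqmodXnM cp (eqmodXn_refl u).
rewrite -mulrA [p * u]mulrC -[X in eqmodXn X _]mulr1; apply: eqmodXn_sym.
exact: eqmodXnM (eqmodXn_refl c) up.
Qed.

(* A discrete transfer recursion: eliminating b from the hypotheses gives
   c (n+1) (1 - t a n) = c n (1 + (1 - t) a n) modulo 'X^N. *)
Lemma transfer_prod (a b d : nat -> {poly B}) (t w : {poly B}) (n : nat) :
    let c n := 1 + \sum_(1 <= m < n) a m * b m in
    (forall m, (0 < m < n)%N -> eqmodXn (b m) (c m + t * a m * b m)) ->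
    (forall m, (0 < m < n)%N -> eqmodXn (a m * d m) w) ->
  eqmodXn (c n * \prod_(1 <= m < n) (d m - t * w))
          (\prod_(1 <= m < n) (d m + (1 - t) * w)).
Proof.
move=> c; elim: n => [|n IH] bE dE.
  by rewrite /c !(big_geq (leqnSn 0)) addr0 mulr1; exact: eqmodXn_refl.
have [->|n0] := posnP n.
  by rewrite /c !(big_geq (leqnn 1)) addr0 mulr1; exact: eqmodXn_refl.
have [s IHs] : eqmodXn (c n * \prod_(1 <= m < n) (d m - t * w))
          (\prod_(1 <= m < n) (d m + (1 - t) * w)).
  by apply: IH => m /andP[m0 mn]; [apply: bE | apply: dE]; rewrite m0 ltnW.
have [r Br] := bE n (introT andP (conj n0 (leqnn _))).
have [r' Ar] := dE n (introT andP (conj n0 (leqnn _))).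
have -> : c n.+1 = c n + a n * b n by rewrite /c big_nat_recr //= addrA.
rewrite !(big_nat_recr _ _ _ n0) /=.
(* The errors are [s] from the induction hypothesis, [r] from the recursion for b n, and [r'] from a
   n * d n. Solving these three congruences for p', c n and w leaves a ring identity. *)
exists (s * (d n + (1 - t) * w)
  + \prod_(1 <= m < n) (d m - t * w)
    * (a n * d n * r + r' * (t * a n * b n + c n))).
move: Br Ar IHs; move: (\prod_(1 <= m < n) _) (\prod_(1 <= m < n) _) => p' p.
move: (c n) (a n) (b n) (d n) => cn an bn dn.
move: ('X^N) => x Br Ar IHs.
have -> : w = an * dn - r' * x by rewrite Ar addrK.
have -> : p' = cn * p - s * x by rewrite IHs addrK.
have -> : cn = bn - t * (an * bn) - r * x by rewrite {1}Br; ring.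
by ring.
Qed.

(** Logarithmic differentiation without division: as a m stands for x / (1 - c m), the left side is
    x times the Leibniz sum of products with one factor omitted. *)
Lemma eqmodXn_deriv_prod (a c : nat -> {poly B}) (x : {poly B}) (n : nat) :
    (forall m, (0 < m < n)%N -> eqmodXn (a m * (1 - c m)) x) ->
  eqmodXn (\prod_(1 <= m < n) (1 - c m) * \sum_(1 <= m < n) a m)
    (x * (\prod_(1 <= m < n) ('X - (c m)%:P))^`().[1]).
Proof.
have deriv1 : (1 : {poly {poly B}})^`() = 0 by rewrite -polyC1 derivC.
elim: n => [|n IH] aE.
  by rewrite !(big_geq (leqnSn 0)) deriv1 horner0 !mulr0; exact: eqmodXn_refl.
have [->|n0] := posnP n.
  by rewrite !(big_geq (leqnn 1)) deriv1 horner0 !mulr0; exact: eqmodXn_refl.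
have [s IHs] := IH (fun m mn => aE m (introT andP
  (conj (andP mn).1 (ltnW (andP mn).2)))).
have [r aEn] := aE n (introT andP (conj n0 (leqnn _))).
rewrite !(big_nat_recr _ _ _ n0) /= derivM derivXsubC mulr1 hornerD hornerM.
rewrite hornerXsubC horner_prod.
have -> : \prod_(1 <= m < n) ('X - (c m)%:P).[1] = \prod_(1 <= m < n) (1 - c m).
  by apply: eq_bigr => m _; rewrite hornerXsubC.
exists (s * (1 - c n) + \prod_(1 <= m < n) (1 - c m) * r).
have -> (p y : {poly B}) : p * (1 - c n) * (y + a n)
  = p * y * (1 - c n) + p * (a n * (1 - c n)) by ring.
by rewrite IHs aEn; ring.
Qed.

End Truncation.

(** * Monomials and coefficients in weight and depth *)

Section Monomials.
Variable T : comNzRingType.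

(* The monomial c Y^i X^j. *)
Definition mono (c : T) (i j : nat) : {poly {poly T}} :=
  c%:P%:P * ('X%:P) ^+ i * 'X^j.

(** The outer variable X marks the weight k and the inner variable Y the depth l, so truncation
    modulo ['X^N] concerns the weight alone. *)
Definition coef2 (k l : nat) (p : {poly {poly T}}) : T := p`_k`_l.

Lemma coef2_sum (k l : nat) (I : Type) (r : seq I) (P : pred I)
    (f : I -> {poly {poly T}}) :
  coef2 k l (\sum_(i <- r | P i) f i) = \sum_(i <- r | P i) coef2 k l (f i).
Proof. by rewrite /coef2 !coef_sum. Qed.

Lemma coef2_mono (k l i j : nat) (c : T) :
  coef2 k l (mono c i j) = if (i == l) && (j == k) then c else 0.
Proof.
rewrite /coef2 /mono -polyC_exp -polyCM coefCM coefXn.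
rewrite -mulrA mul_polyC; case: (eqVneq k j) => _.
  rewrite mulr1 coefZ coefXn andbT eq_sym.
  by case: eqP; rewrite ?mulr1 ?mulr0.
by rewrite mulr0 scaler0 coef0 andbF.
Qed.

Lemma monoM (c d : T) (i j i' j' : nat) :
  mono c i j * mono d i' j' = mono (c * d) (i + i') (j + j').
Proof. by rewrite /mono !polyCM !exprD; ring. Qed.

Lemma mono1 : mono 1 0 0 = 1.
Proof. by rewrite /mono !polyC1 !expr0 !mulr1. Qed.

Lemma mono0 (i j : nat) : mono 0 i j = 0.
Proof. by rewrite /mono !polyC0 !mul0r. Qed.

Lemma monoD (c d : T) (i j : nat) : mono (c + d) i j = mono c i j + mono d i j.
Proof. by rewrite /mono !polyCD; ring. Qed.

Lemma mono_sum (I : Type) (r : seq I) (P : pred I) (f : I -> T) (i j : nat) :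
  mono (\sum_(x <- r | P x) f x) i j = \sum_(x <- r | P x) mono (f x) i j.
Proof.
exact: (big_morph (fun c => mono c i j) (fun c d => monoD c d i j) (mono0 i j)).
Qed.

Lemma mono_prod (I : finType) (c : I -> T) (i j : I -> nat) :
  \prod_a mono (c a) (i a) (j a) = mono (\prod_a c a) (\sum_a i a) (\sum_a j a).
Proof.
by rewrite /mono !big_split /= !prodrXr !rmorph_prod.
Qed.

Lemma eqmodXn_mono0 (N : nat) (c : T) (i j : nat) :
  (N <= j)%N -> eqmodXn N (mono c i j) 0.
Proof.
move=> leNj; exists (c%:P%:P * 'X%:P ^+ i * 'X^(j - N)).
by rewrite add0r /mono -[RHS]mulrA -exprD subnK.
Qed.

Lemma coef2CM (k l : nat) (c : T) (p : {poly {poly T}}) :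
  coef2 k l (c%:P%:P * p) = c * coef2 k l p.
Proof. by rewrite /coef2 !coefCM. Qed.

(** Expanding the product picks one monomial per factor; their exponents add up, which produces the
    conditions on the sums of the indices. *)
Lemma coef2_prod2 (m n k l : nat) (g : 'I_m -> 'I_n -> 'I_n -> T) :
  coef2 k l (\prod_a \sum_i \sum_j mono (g a i j) i j) =
  \sum_(i : {ffun 'I_m -> 'I_n})
  \sum_(j : {ffun 'I_m -> 'I_n} | ((\sum_a i a)%N == l) && ((\sum_a j a)%N == k))
     \prod_a g a (i a) (j a).
Proof.
rewrite bigA_distr_bigA coef2_sum; apply: eq_bigr => i _.
rewrite bigA_distr_bigA coef2_sum [RHS]big_mkcond; apply: eq_bigr => j _.
by rewrite mono_prod coef2_mono.
Qed.

Lemma coef2_prod3 (m n K k l : nat) (g : 'I_m -> 'I_n -> 'I_n -> 'I_K -> T) :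
  coef2 k l (\prod_a \sum_i \sum_j \sum_w mono (g a i j w) i (w + j)) =
  \sum_(i : {ffun 'I_m -> 'I_n}) \sum_(j : {ffun 'I_m -> 'I_n})
  \sum_(w : {ffun 'I_m -> 'I_K} | ((\sum_a i a)%N == l)
      && ((\sum_a w a + \sum_a j a)%N == k))
     \prod_a g a (i a) (j a) (w a).
Proof.
rewrite bigA_distr_bigA coef2_sum; apply: eq_bigr => i _.
rewrite bigA_distr_bigA coef2_sum; apply: eq_bigr => j _.
rewrite bigA_distr_bigA coef2_sum [RHS]big_mkcond; apply: eq_bigr => w _.
by rewrite mono_prod coef2_mono big_split.
Qed.

End Monomials.

Lemma prod_if (T : comNzRingType) (I : finType) (p : pred I) (x : I -> T) :
  \prod_a (if p a then x a else 0) = if [forall a, p a] then \prod_a x a else 0.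
Proof.
case: forallP => [pI|pNI]; first by apply: eq_bigr => a _; rewrite pI.
have /forallPn[a /negPf pa] : ~~ [forall a, p a] by apply/forallP.
by rewrite (bigD1 a) //= pa mul0r.
Qed.

(** * The generating function and its transfer recursion *)

Section GeneratingFunction.
Variables (F : fieldType) (q : F) (K : nat).

Definition depth_gf (l m : nat) : {poly {poly {poly F}}} :=
  \sum_(s : l.-tuple 'I_K | all (leq 1) (map val s))
    mono (wnested q (map val s) m) l (sumn (map val s)).

(** The exponent [e] of Y is 1 when depth is counted, and 0 for the depth-one series in the weight
    alone. *)
Definition zterm_gf (e m : nat) : {poly {poly {poly F}}} :=
  \sum_(k < K | (0 < k)%N) mono (zterm q m k)%:P e k.

(** The 1 is the empty index; otherwise m is the largest chain variable and the remaining l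
    variables are at most m. *)
Definition zbart_gf (n : nat) : {poly {poly {poly F}}} :=
  1 + \sum_(1 <= m < n) zterm_gf 1 m * \sum_(l < K) depth_gf l m.

Lemma depth_gf0 (m : nat) : depth_gf 0 m = 1.
Proof.
rewrite /depth_gf (big_tuple0 (fun s => all (leq 1) (map val s))
  (fun s => mono (wnested q (map val s) m) 0 (sumn (map val s)))) /=.
exact: mono1.
Qed.

Lemma zterm_gfM (l m : nat) (h : seq nat -> {poly F}) :
  zterm_gf 1 m * (\sum_(s : l.-tuple 'I_K | all (leq 1) (map val s))
     mono (h (map val s)) l (sumn (map val s))) =
  \sum_(k < K | (0 < k)%N)
    \sum_(s : l.-tuple 'I_K | all (leq 1) (map val s))
      mono (zterm q m k *: h (map val s)) l.+1 (k + sumn (map val s)).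
Proof.
rewrite big_distrlr /=; apply: eq_bigr => k _; apply: eq_bigr => s _.
by rewrite monoM mul_polyC.
Qed.

Lemma depth_gfS (l m : nat) :
  depth_gf l.+1 m = \sum_(1 <= m' < m) zterm_gf 1 m' * depth_gf l m'
     + zterm_gf 1 m * (('X)%:P%:P * depth_gf l m).
Proof.
transitivity (\sum_(1 <= m' < m) \sum_(k < K | (0 < k)%N)
      \sum_(s : l.-tuple 'I_K | all (leq 1) (map val s))
        mono (zterm q m' k *: wnested q (map val s) m') l.+1 (k + sumn (map val s))
    + \sum_(k < K | (0 < k)%N)
      \sum_(s : l.-tuple 'I_K | all (leq 1) (map val s))
        mono (zterm q m k *: ('X * wnested q (map val s) m)) l.+1
          (k + sumn (map val s))).
  rewrite exchange_big -big_split.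
  rewrite /depth_gf (big_tuple_pos _ _ (fun s => mono (wnested q s m) l.+1 (sumn s))).
  apply: eq_bigr => k _ /=.
  rewrite exchange_big -big_split; apply: eq_bigr => s _ /=.
  by rewrite monoD mono_sum.
congr (_ + _).
  apply: eq_bigr => m' _; apply: esym.
  exact: (zterm_gfM l m' (fun s => wnested q s m')).
rewrite -(zterm_gfM l m (fun s => 'X * wnested q s m)); congr (_ * _).
rewrite mulr_sumr; apply: eq_bigr => s _.
by rewrite /mono !polyCM -!mulrA.
Qed.

(** Positive entries make the weight at least the depth, so depths from K on are invisible modulo
    X^K. *)
Lemma depth_gf_eqmod0 (m : nat) : eqmodXn K (depth_gf K m) 0.
Proof.
rewrite /depth_gf; elim/big_ind: _ => [|p p' *|s s0]; first exact: eqmodXn_refl.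
  by rewrite -[0]addr0; apply: eqmodXnD.
by apply: eqmodXn_mono0; move/sumn_pos: s0; rewrite size_map size_tuple.
Qed.

(** Summing [depth_gfS] over l shifts the depth by one, and the surplus term of depth K goes into
    the error. This is the recursion that [transfer_prod] takes as input. *)
Lemma sum_depth_gf (m : nat) : exists r : {poly {poly {poly F}}},
  \sum_(l < K) depth_gf l m = zbart_gf m
    + 'X%:P%:P * zterm_gf 1 m * \sum_(l < K) depth_gf l m + r * 'X^K.
Proof.
have [r0 dK0] := depth_gf_eqmod0 m; exists (- r0).
transitivity (1 + \sum_(l < K) depth_gf l.+1 m - r0 * 'X^K).
  apply: (canRL (addrK _)).
  transitivity (\sum_(l < K) depth_gf l m + depth_gf K m).
    by congr (_ + _); apply: esym; rewrite -[RHS]add0r.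
  transitivity (\sum_(l < K.+1) depth_gf l m); first by rewrite big_ord_recr.
  by rewrite big_ord_recl depth_gf0.
rewrite mulNr; congr (_ - _); rewrite -addrA; congr (_ + _).
transitivity (\sum_(l < K) (\sum_(1 <= m' < m) zterm_gf 1 m' * depth_gf l m'
    + zterm_gf 1 m * (('X)%:P%:P * depth_gf l m))).
  by apply: eq_bigr => l _; exact: depth_gfS.
rewrite big_split /= exchange_big /=; congr (_ + _).
  by apply: eq_bigr => m' _; rewrite mulr_sumr.
by rewrite -!mulr_sumr mulrA [in RHS](mulrC _ (zterm_gf 1 m)).
Qed.

Definition denom (m : nat) : {poly {poly {poly F}}} :=
  1 - (q ^+ m)%:P%:P%:P * (1 + 'X).

(** With u = q^m, the terms u^(k-1) X^k / (1-u)^k form a geometric series with sum X / (1 -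
    u(1+X)). *)
Lemma zterm_gf_denom (e m : nat) : (0 < K)%N -> 1 - q ^+ m != 0 ->
  exists r, zterm_gf e m * denom m = 'X%:P ^+ e * 'X + r * 'X^K.
Proof.
move=> K0 u1; pose i (c : F) : {poly {poly {poly F}}} := c%:P%:P%:P.
have -> : zterm_gf e m = \sum_(1 <= k < K) i (zterm q m k) * 'X%:P ^+ e * 'X^k.
  rewrite big_geq_mkord; apply: eq_bigr => k _.
  by [].
move: ('X%:P ^+ e) => Y.
(* The product telescopes and leaves its last term. Writing it with index K and a factor 1-u covers
   K = 1 too, where u times the term of index K-1 would be wrong. *)
exists (- (Y * i (zterm q m K * (1 - q ^+ m)))).
case: K K0 => // N _; elim: N => [|N IH].
  rewrite big_geq // mul0r /zterm /= mul0n !expr0 !expr1 div1r mulVf // /i.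
  by rewrite !polyC1; ring.
rewrite big_nat_recr //= mulrDl IH.
have -> : zterm q m N.+2 * (1 - q ^+ m) = q ^+ m * zterm q m N.+1.
  rewrite /zterm /= mulSn exprD [_ ^+ N.+2]exprSr.
  by field; rewrite u1 expf_neq0.
rewrite /denom /i !polyCM !polyCB !polyC1 !exprS; ring.
Qed.

Lemma zbart_gf_prod (n : nat) :
    (0 < K)%N -> (forall m, (0 < m < n)%N -> 1 - q ^+ m != 0) ->
  eqmodXn K
    (zbart_gf n * \prod_(1 <= m < n) (denom m - 'X%:P%:P * ('X%:P * 'X)))
    (\prod_(1 <= m < n) (denom m + (1 - 'X%:P%:P) * ('X%:P * 'X))).
Proof.
move=> K0 q1; apply: transfer_prod => m mn; first exact: sum_depth_gf.
by have := zterm_gf_denom 1 K0 (q1 m mn); rewrite expr1.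
Qed.

Lemma coef2_zterm_depth_gf (k l l' m : nat) :
  coef2 k l (zterm_gf 1 m * depth_gf l' m) =
  if l'.+1 == l then
    \sum_(a < K | (0 < a)%N)
      \sum_(s : l'.-tuple 'I_K | all (leq 1) (map val s) && (a + sumn (map val s) == k)%N)
        zterm q m a *: wnested q (map val s) m
  else 0.
Proof.
rewrite (zterm_gfM l' m (fun s => wnested q s m)) coef2_sum.
case: ifP => l'l; last first.
  rewrite big1 // => a _; rewrite coef2_sum big1 // => s _.
  by rewrite coef2_mono l'l.
apply: eq_bigr => a _; rewrite coef2_sum big_mkcondr; apply: eq_bigr => s _.
by rewrite coef2_mono l'l.
Qed.

End GeneratingFunction.

(** For K = k+1 the entries range over the same ordinals as in [Gzt], so the coefficient is exact.
    The largest variable m is split off by [zbart_wnested]. *)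
Lemma Gzt_coef2 (F : fieldType) (q : F) (n k l : nat) :
    (forall m, (0 < m < n)%N -> 1 - q ^+ m != 0) -> (l <= k)%N ->
  Gzt n k l q = coef2 k l (zbart_gf q k.+1 n).
Proof.
move=> q1 lk; rewrite /zbart_gf.
have -> : coef2 k l (1 + \sum_(1 <= m < n) zterm_gf q k.+1 1 m *
      \sum_(l' < k.+1) depth_gf q k.+1 l' m) =
    (if (0%N == l) && (0%N == k) then 1 else 0) +
    \sum_(1 <= m < n) \sum_(l' < k.+1)
      coef2 k l (zterm_gf q k.+1 1 m * depth_gf q k.+1 l' m).
  rewrite -mono1 /coef2 !coefD -!/(coef2 _ _ _) coef2_mono coef2_sum.
  by congr (_ + _); apply: eq_bigr => m _; rewrite mulr_sumr coef2_sum.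
under eq_bigr do under eq_bigr do rewrite coef2_zterm_depth_gf.
case: l lk => [|l] lk.
  rewrite [X in _ + X]big1 ?addr0; last by move=> m _; rewrite big1.
  rewrite /Gzt eqxx andbT [k == _]eq_sym; case: eqP => // k0.
  rewrite (big_tuple0 (fun s => all (leq 1) (map val s) && (sumn (map val s) == k))
     (fun s => zbart n q (map val s))) /=.
  by case: eqP.
rewrite /= add0r /Gzt andbF.
rewrite [RHS](eq_bigr (fun m => \sum_(a < k.+1 | (0 < a)%N)
    \sum_(s : l.-tuple 'I_k.+1
        | all (leq 1) (map val s) && (a + sumn (map val s) == k)%N)
      zterm q m a *: wnested q (map val s) m)); last first.
  move=> m _; rewrite (bigD1 (Ordinal (leqW lk))) //= eqxx [X in _ + X]big1 ?addr0 //.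
  by move=> i; rewrite eqSS -val_eqE => /negPf->.
rewrite big_mkcondr (big_tuple_pos _ _ (fun s => if sumn s == k then zbart n q s else 0)).
rewrite [RHS]exchange_big; apply: eq_bigr => a a0 /=.
rewrite [RHS]exchange_big [RHS]big_mkcondr; apply: eq_bigr => s s0 /=.
by case: ifP => // _; rewrite zbart_wnested //= a0.
Qed.

(** * Products over the powers of a primitive root of unity *)

Section RootsOfUnity.
Variables (F : fieldType) (n : nat) (z : F).
Hypothesis z_prim : n.-primitive_root z.

(** Homogenises the factorisation of X^n - 1 by evaluating at a/b; b = 0 is separate. *)
Lemma prod_sub_rootsF (L : fieldType) (f : {rmorphism F -> L}) (a b : L) :
  \prod_(0 <= m < n) (a - f (z ^+ m) * b) = a ^+ n - b ^+ n.
Proof.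
have [->|b0] := eqVneq b 0.
  under eq_bigr do rewrite mulr0 subr0.
  by rewrite prodr_const_nat subn0 expr0n eqn0Ngt (prim_order_gt0 z_prim) subr0.
have fz : n.-primitive_root (f z) by rewrite fmorph_primitive_root.
have := congr1 (fun p => p.[a / b] * b ^+ n) (factor_Xn_sub_1 fz).
rewrite horner_prod !hornerE mulrBl mul1r expr_div_n divfK ?expf_neq0 // => <-.
rewrite -[X in b ^+ X]subn0 -prodr_const_nat -big_split; apply: eq_bigr => m _ /=.
by rewrite !hornerE mulrBl divfK // rmorphXn.
Qed.

(** Descends from the fraction field of B; [f] lets B be a polynomial ring over F. *)
Lemma prod_sub_roots (B : idomainType) (f : {rmorphism F -> B}) (a b : B) :
  \prod_(0 <= m < n) (a - f (z ^+ m) * b) = a ^+ n - b ^+ n.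
Proof.
apply/eqP; rewrite -tofrac_eq rmorphB !rmorphXn rmorph_prod /=; apply/eqP.
rewrite -(prod_sub_rootsF (@tofrac B \o f)); apply: eq_bigr => m _.
by rewrite /= rmorphB rmorphM.
Qed.

(** Take a = 1 + yx and b = 1 + x in [prod_sub_roots]: the factor m = 0 is -x(1-y), and x(1-y) also
    divides each x^(j+1) - (yx)^(j+1) of the binomial expansion, so it cancels. *)
Lemma prod_roots_binomial (B : idomainType) (f : {rmorphism F -> B}) (x y : B) :
    x * (1 - y) != 0 ->
  \prod_(1 <= m < n) (1 - f (z ^+ m) * (1 + x) + y * x) =
    \sum_(j < n) 'C(n, j.+1)%:R * x ^+ j * \sum_(i < j.+1) y ^+ i.
Proof.
move=> xy0; apply: (mulfI xy0).
transitivity ((1 + x) ^+ n - (1 + y * x) ^+ n).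
  rewrite -[RHS]opprB -(prod_sub_roots f) [in RHS]big_ltn ?(prim_order_gt0 z_prim) //.
  rewrite expr0 rmorph1 -mulNr; congr (_ * _); first by ring.
  by apply: eq_bigr => m _; ring.
rewrite !exprDn !big_ord_recl /= !expr0 !bin0 opprD addrACA subrr add0r -sumrB.
rewrite mulr_sumr; apply: eq_bigr => j _.
rewrite !expr1n !mul1r /bump /= !add1n -mulrnBl exprMn -mulr_natl.
have -> : x ^+ j.+1 - y ^+ j.+1 * x ^+ j.+1 = - (y ^+ j.+1 - 1) * x ^+ j.+1 by ring.
by rewrite subrX1 exprS; ring.
Qed.

(* The derivative of prod_m (T - u_m b) = T^n - b^n at T = 1. *)
Lemma deriv_prod_roots (B : idomainType) (f : {rmorphism F -> B}) (x : B) :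
  \prod_(1 <= m < n) (1 - f (z ^+ m) * (1 + x))
    - x * (\prod_(1 <= m < n) ('X - (f (z ^+ m) * (1 + x))%:P))^`().[1] = n%:R.
Proof.
have := congr1 (fun p => p^`().[1]) (prod_sub_roots (polyC \o f) 'X (1 + x)%:P).
rewrite -polyC_exp derivB derivC subr0 derivXn hornerMn hornerXn expr1n => <-.
rewrite [in RHS]big_ltn ?(prim_order_gt0 z_prim) // expr0 /= rmorph1 mul1r.
rewrite derivM derivXsubC mul1r hornerD hornerM hornerXsubC horner_prod.
have E m : ('X - (f (z ^+ m))%:P * (1 + x)%:P) = 'X - (f (z ^+ m) * (1 + x))%:P.
  by rewrite polyCM.
under [in X in _ = X + _]eq_bigr do rewrite E hornerXsubC.
under [in X in _ = _ + X]eq_bigr do rewrite E.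
by ring.
Qed.

Lemma prim_expr_neq1 (m : nat) : (0 < m < n)%N -> 1 - z ^+ m != 0.
Proof.
move=> /andP[m0 mn]; rewrite subr_eq0 eq_sym -(prim_order_dvd z_prim).
by apply: contraTN mn => /(dvdn_leq m0); rewrite -leqNgt.
Qed.

End RootsOfUnity.

(** * The binomial polynomials P(c) and their splittings *)

Section BinomialSeries.
Variables (T : comNzRingType) (n : nat).

(** P(c) for trivial [r], and otherwise a part of it. Excluded pairs get coefficient 0, so that
    products expand over full index ranges. *)
Definition binom_gf (r : rel nat) (c : T) : {poly {poly T}} :=
  \sum_(i < n) \sum_(j < n)
    mono (if (i <= j)%N && r i j then 'C(n, j.+1)%:R * c ^+ i else 0) i j.

Lemma binom_gf_horner (c : T) :
  binom_gf (fun _ _ => true) c =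
  \sum_(j < n) 'C(n, j.+1)%:R * 'X ^+ j * \sum_(i < j.+1) (c%:P%:P * 'X%:P) ^+ i.
Proof.
rewrite /binom_gf exchange_big; apply: eq_bigr => j _ /=.
rewrite (big_ord_widen n (fun i => (c%:P%:P * 'X%:P) ^+ i)) // mulr_sumr.
rewrite [RHS]big_mkcond; apply: eq_bigr => i _; rewrite andbT ltnS.
case: ifP => _; last by rewrite mono0.
rewrite /mono !polyCM !polyC_natr !polyC_exp exprMn.
by rewrite -!mulrA; congr (_ * _); rewrite mulrA mulrC.
Qed.

Lemma binom_gf_dvd (r : rel nat) (c : T) :
    (forall i j, (i <= j)%N -> r i j -> (0 < j)%N) ->
  exists p, binom_gf r c = p * 'X.
Proof.
move=> r0; exists (\sum_(i < n) \sum_(j < n)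
    mono (if (i <= j)%N && r i j then 'C(n, j.+1)%:R * c ^+ i else 0) i j.-1).
rewrite mulr_suml; apply: eq_bigr => i _; rewrite mulr_suml; apply: eq_bigr => j _.
case: ifP => [/andP[ij rij]|_]; last by rewrite !mono0 mul0r.
by rewrite /mono -[RHS]mulrA -exprSr prednK // (r0 i).
Qed.

Lemma binom_gf_j0 (c : T) : (0 < n)%N ->
  binom_gf (fun _ _ => true) c = n%:R + binom_gf (fun _ j => (0 < j)%N) c.
Proof.
move=> n0; pose o := Ordinal n0.
have -> : n%:R = \sum_(i < n) \sum_(j < n)
    mono (if (i == o) && (j == o) then n%:R else 0 : T) i j.
  rewrite (bigD1 o) //= [X in _ + X]big1 ?addr0; last first.
    by move=> i /negPf->; rewrite big1 // => j _; rewrite mono0.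
  rewrite (bigD1 o) //= [X in _ + X]big1 ?addr0; last first.
    by move=> j /negPf->; rewrite mono0.
  by rewrite /mono !polyC_natr !expr0 !mulr1.
rewrite /binom_gf -big_split; apply: eq_bigr => i _ /=.
rewrite -big_split; apply: eq_bigr => j _ /=; rewrite -monoD; congr mono.
rewrite -!val_eqE /= andbT; case: (posnP j) => [->|j0].
  rewrite leqn0 andbF andbT; case: eqP => [->|]; rewrite ?addr0 //.
  by rewrite bin1 mulr1.
by rewrite andbF add0r andbT.
Qed.

(** The part with i = 0 is P(0), because 0^0 = 1 and 0^i = 0 for i > 0. *)
Lemma binom_gf_i0 (c : T) :
  binom_gf (fun _ _ => true) c =
    binom_gf (fun _ _ => true) 0 + binom_gf (fun i _ => (0 < i)%N) c.
Proof.
rewrite /binom_gf -big_split; apply: eq_bigr => i _ /=.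
rewrite -big_split; apply: eq_bigr => j _ /=; rewrite -monoD; congr mono.
rewrite !andbT; case: ifP => _; last by rewrite addr0.
case: (posnP i) => [->|i0]; first by rewrite !expr0 addr0.
by rewrite expr0n eqn0Ngt i0 mulr0 add0r.
Qed.

End BinomialSeries.

(** * The two expansions of P(1-t)/P(-t) *)

Section PrimitiveRoot.
Variables (F : fieldType) (n : nat) (z : F).
Hypotheses (z_prim : n.-primitive_root z) (n_neq0 : n%:R != 0 :> F).

Lemma binom_gfE (c : {poly F}) :
  binom_gf n (fun _ _ => true) c =
  \prod_(1 <= m < n) (denom z m + c%:P%:P * ('X%:P * 'X)).
Proof.
rewrite binom_gf_horner.
rewrite -(prod_roots_binomial z_prim (polyC \o (polyC \o polyC))).
  by apply: eq_bigr => m _; rewrite mulrA.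
(* The factor X(1 - cY) to be cancelled is nonzero because 1 - cY has constant term 1 in Y. *)
rewrite mulf_neq0 ?polyX_eq0 // -polyCM -polyCB polyC_eq0.
apply/eqP => /(congr1 (fun p : {poly {poly F}} => p`_0)).
by rewrite coefB coefMX coef1 subr0 coef0; apply/eqP; rewrite oner_eq0.
Qed.

Definition zbar1_gf (K : nat) : {poly {poly {poly F}}} :=
  \sum_(w < K) mono (zbar1 n z w)%:P 0 w.

Lemma zbar1_gfE (K : nat) : (0 < K)%N ->
  - zbar1_gf K = 1 - \sum_(1 <= m < n) zterm_gf z K 0 m.
Proof.
case: K => // K _; rewrite /zbar1_gf big_ord_recl /zbar1 /= polyCN polyC1.
have -> : mono (-1 : {poly F}) 0 0 = -1.
  by rewrite /mono !polyCN !polyC1 !expr0 !mulr1.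
rewrite opprD opprK; congr (1 - _).
rewrite /zterm_gf [RHS]exchange_big [RHS]big_mkcond [RHS]big_ord_recl /= add0r.
apply: eq_bigr => w _ /=; rewrite -mono_sum zbarE /=.
by under eq_bigr do rewrite mulr1; rewrite rmorph_sum.
Qed.

(** The convention of value -1 at index 0 makes the negated series 1 - sum_m X / (1 - u_m(1+X)).
    Multiplied by P(0), it becomes the left side of [deriv_prod_roots]. *)
Lemma zbar1_gf_inverse (K : nat) : (0 < K)%N ->
  eqmodXn K (- zbar1_gf K * \prod_(1 <= m < n) denom z m) n%:R.
Proof.
move=> K0; rewrite (zbar1_gfE K0) mulrBl mul1r mulrC.
rewrite -(deriv_prod_roots z_prim (polyC \o (polyC \o polyC)) 'X).
have [|r Er] := @eqmodXn_deriv_prod _ K (zterm_gf z K 0)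
  (fun m => (z ^+ m)%:P%:P%:P * (1 + 'X)) 'X n.
  move=> m mn; have [r Er] := zterm_gf_denom 0 K0 (prim_expr_neq1 z_prim mn).
  by exists r; apply: etrans Er _; rewrite mul1r.
exists (- r); rewrite mulNr -addrA -opprD; congr (_ - _).
exact: Er.
Qed.

(** Common core of both formulas: P(-t) is split into [p0], inverted by [v], and a part divisible by
    X, expanded geometrically. *)
Lemma Gzt_inverse (k l : nat) (r : rel nat) (v p0 : {poly {poly {poly F}}}) :
    (l <= k)%N -> eqmodXn k.+1 (v * p0) 1 ->
    binom_gf n (fun _ _ => true) (- 'X) = p0 + binom_gf n r (- 'X) ->
    (forall i j, (i <= j)%N -> r i j -> (0 < j)%N) ->
  Gzt n k l z = \sum_(0 <= m < k.+1) (-1) ^+ m * coef2 k l (v ^+ m.+1 *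
    (binom_gf n (fun _ _ => true) (1 - 'X) * binom_gf n r (- 'X) ^+ m)).
Proof.
move=> lk vp0 split_gf r_gt0.
rewrite (Gzt_coef2 (prim_expr_neq1 z_prim) lk).
have [p p1E] := binom_gf_dvd n (- 'X : {poly F}) r_gt0.
have inv := geometric_inverse vp0 p1E; rewrite -split_gf in inv.
have CP : eqmodXn k.+1 (zbart_gf z k.+1 n * binom_gf n (fun _ _ => true) (- 'X))
    (binom_gf n (fun _ _ => true) (1 - 'X)).
  have := zbart_gf_prod (ltn0Sn k) (prim_expr_neq1 z_prim).
  rewrite !binom_gfE !polyCN !polyCB !polyC1.
  by under eq_bigr do rewrite -mulNr.
rewrite /coef2 (eqmodXn_coef (ltnSn k) (eqmodXn_divr CP inv)) -/(coef2 k l _).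
rewrite mulr_sumr coef2_sum; apply: eq_bigr => m _.
rewrite -coef2CM; congr coef2.
by rewrite !polyC_exp !polyCN !polyC1; ring.
Qed.

(** The factor a = 0 is the numerator P(1-t); only the factors a >= 1, from the geometric series,
    carry the restriction [r]. *)
Lemma prod_binom_gf (r : rel nat) (m : nat) :
  binom_gf n (fun _ _ => true) (1 - 'X) * binom_gf n r (- 'X) ^+ m =
  \prod_(a < m.+1) \sum_(i < n) \sum_(j < n)
    mono (if (i <= j)%N && ((a != ord0) ==> r i j)
          then 'C(n, j.+1)%:R * (if a == ord0 then 1 - 'X else - 'X : {poly F}) ^+ i
          else 0) i j.
Proof.
rewrite big_ord_recl /=; congr (_ * _).
by rewrite -[X in _ ^+ X]card_ord -prodr_const.
Qed.

Lemma prod_weights (m l : nat) (i j : {ffun 'I_m.+1 -> 'I_n}) :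
    (\sum_a i a)%N = l ->
  \prod_a ('C(n, (j a).+1)%:R *
      (if a == ord0 then 1 - 'X else - 'X : {poly F}) ^+ i a) =
  (\prod_a 'C(n, (j a).+1)%:R) *:
      ((1 - 'X) ^+ i ord0 * (- 'X) ^+ (l - i ord0)).
Proof.
move=> <-; rewrite big_split -mul_polyC rmorph_prod /=; congr (_ * _).
  by apply: eq_bigr => a _; rewrite polyC_natr.
rewrite [LHS]big_ord_recl [in RHS]big_ord_recl /= addKn; congr (_ * _).
by rewrite prodrXr.
Qed.

Lemma inv_natK : (n%:R^-1)%:P%:P%:P * n%:R = 1 :> {poly {poly {poly F}}}.
Proof.
have := congr1 (fun c : F => c%:P%:P%:P) (mulVf n_neq0).
by rewrite /= !polyCM !polyC_natr !polyC1.
Qed.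

Lemma Gzt_binomial (k l : nat) : (l <= k)%N ->
  Gzt n k l z =
    \sum_(0 <= m < k.+1) ((-1) ^+ m / n%:R ^+ m.+1) *:
      \sum_(i : {ffun 'I_m.+1 -> 'I_n})
      \sum_(j : {ffun 'I_m.+1 -> 'I_n}
           | [&& (\sum_a i a)%N == l, (\sum_a j a)%N == k,
                 [forall a, (i a <= j a)%N]
               & [forall a, (a != ord0) ==> (1 <= j a)%N]])
        (\prod_a 'C(n, (j a).+1)%:R) *:
          ((1 - 'X) ^+ i ord0 * (- 'X) ^+ (l - i ord0)).
Proof.
(* Here p0 = n is the term j = 0 of P(-t), and v = 1/n. *)
move=> lk; rewrite (@Gzt_inverse k l (fun _ j => (0 < j)%N)
  (n%:R^-1)%:P%:P%:P n%:R lk) //; first 1 last.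
- by rewrite inv_natK; exact: eqmodXn_refl.
- by rewrite (binom_gf_j0 _ (prim_order_gt0 z_prim)).
apply: eq_bigr => m _.
rewrite -!polyC_exp coef2CM mulrA.
have -> : (-1) ^+ m * (n%:R^-1 ^+ m.+1)%:P = ((-1) ^+ m / n%:R ^+ m.+1)%:P :> {poly F}.
  by rewrite exprVn polyCM [((-1) ^+ m)%:P]polyC_exp polyCN polyC1.
rewrite mul_polyC; congr (_ *: _).
rewrite prod_binom_gf coef2_prod2; apply: eq_bigr => i _.
rewrite big_mkcond [RHS]big_mkcond; apply: eq_bigr => j _.
case: eqP => //= il; case: eqP => //= _.
rewrite prod_if (prod_weights _ il).
congr (if _ then _ else _); apply/forallP/andP => [ij|[/forallP ij /forallP j0] a].
  by split; apply/forallP => a; case/andP: (ij a).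
by rewrite ij j0.
Qed.

Lemma Gzt_zbar1 (k l : nat) : (l <= k)%N ->
  Gzt n k l z =
    - \sum_(0 <= m < k.+1) (1 / n%:R ^+ m.+1) *:
      \sum_(i : {ffun 'I_m.+1 -> 'I_n})
      \sum_(j : {ffun 'I_m.+1 -> 'I_n})
      \sum_(w : {ffun 'I_m.+1 -> 'I_k.+1}
           | [&& (\sum_a i a)%N == l, (\sum_a w a + \sum_a j a)%N == k,
                 [forall a, (i a <= j a)%N]
               & [forall a, (a != ord0) ==> (1 <= i a)%N]])
        (\prod_a ('C(n, (j a).+1)%:R * zbar1 n z (w a))) *:
          ((1 - 'X) ^+ i ord0 * (- 'X) ^+ (l - i ord0)).
Proof.
(* Here p0 = P(0) is the part with i = 0, and v is -1/n times the depth-one series. *)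
move=> lk; rewrite (@Gzt_inverse k l (fun i _ => (0 < i)%N)
  ((- n%:R^-1)%:P%:P%:P * zbar1_gf k.+1) (\prod_(1 <= m < n) denom z m) lk); first last.
- by move=> i j ij i0; exact: leq_trans ij.
- rewrite binom_gf_i0 binom_gfE; congr (_ + _).
  by apply: eq_bigr => m _; rewrite !polyC0 mul0r addr0.
- have [r Er] := zbar1_gf_inverse (ltn0Sn k).
  exists ((n%:R^-1)%:P%:P%:P * r).
  rewrite !polyCN mulNr -mulrN -mulrA Er mulrDr mulrA; congr (_ + _).
  exact: inv_natK.
rewrite -sumrN; apply: eq_bigr => m _.
rewrite exprMn -!polyC_exp -mulrA coef2CM mulrA.
(* The signs of the geometric series cancel those of v^(m+1) except for one, the global minus
   sign. *)
have -> : (-1) ^+ m * ((- n%:R^-1) ^+ m.+1)%:P = - (1 / n%:R ^+ m.+1)%:P :> {poly F}.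
  have s2 : (-1) ^+ m * ((-1) ^+ m)%:P = 1 :> {poly F}.
    by rewrite polyC_exp polyCN polyC1 -exprMn mulrNN mulr1 expr1n.
  rewrite div1r [(- n%:R^-1) ^+ _]exprNn [(-1) ^+ m.+1]exprS mulN1r.
  rewrite mulNr polyCN polyCM exprVn.
  by rewrite mulrN mulrA s2 mul1r.
rewrite mulNr mul_polyC; congr (- (_ *: _)).
(* The m+1 copies of the depth-one series are dealt out one to each factor a, which creates the
   indices l_a. *)
have -> : zbar1_gf k.+1 ^+ m.+1 *
    (binom_gf n (fun _ _ => true) (1 - 'X) *
      binom_gf n (fun i _ => (0 < i)%N) (- 'X) ^+ m) =
  \prod_(a < m.+1) \sum_(i < n) \sum_(j < n) \sum_(w < k.+1)
    mono (if (i <= j)%N && ((a != ord0) ==> (0 < i)%N)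
          then (zbar1 n z w)%:P * ('C(n, j.+1)%:R *
            (if a == ord0 then 1 - 'X else - 'X : {poly F}) ^+ i)
          else 0) i (w + j).
  have -> : zbar1_gf k.+1 ^+ m.+1 = \prod_(a < m.+1) zbar1_gf k.+1.
    by rewrite prodr_const card_ord.
  rewrite prod_binom_gf -big_split.
  apply: eq_bigr => a _ /=; rewrite mulr_sumr; apply: eq_bigr => i _.
  rewrite mulr_sumr; apply: eq_bigr => j _.
  rewrite mulr_suml; apply: eq_bigr => w _.
  apply: etrans (monoM _ _ _ _ _ _) _; congr mono.
  by case: ifP => _; [|exact: mulr0].
rewrite coef2_prod3; apply: eq_bigr => i _; apply: eq_bigr => j _.
rewrite big_mkcond [RHS]big_mkcond; apply: eq_bigr => w _.
case: eqP => //= il; case: eqP => //= _.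
rewrite prod_if big_split /= (prod_weights _ il).
congr (if _ then _ else _).
  apply/forallP/andP => [ij|[/forallP ij /forallP j0] a].
    by split; apply/forallP => a; case/andP: (ij a).
  by rewrite ij j0.
rewrite -rmorph_prod mul_polyC scalerA big_split.
by congr (_ *: _); exact: mulrC.
Qed.

End PrimitiveRoot.

Theorem corollary1p4 (R : realType) (n : nat) (zeta : R[i]) (k l : nat)
    (n_gt0 : (0 < n)%N) (zeta_prim : n.-primitive_root zeta)
    (le_lk : (l <= k)%N) :
  Gzt n k l zeta =
    \sum_(0 <= m < k.+1) ((-1) ^+ m / n%:R ^+ m.+1) *:
      \sum_(i : {ffun 'I_m.+1 -> 'I_n})
      \sum_(j : {ffun 'I_m.+1 -> 'I_n}
           | [&& (\sum_a i a)%N == l, (\sum_a j a)%N == k,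
                 [forall a, (i a <= j a)%N]
               & [forall a, (a != ord0) ==> (1 <= j a)%N]])
        (\prod_a 'C(n, (j a).+1)%:R) *:
          ((1 - 'X) ^+ i ord0 * (- 'X) ^+ (l - i ord0))
  /\
  Gzt n k l zeta =
    - \sum_(0 <= m < k.+1) (1 / n%:R ^+ m.+1) *:
      \sum_(i : {ffun 'I_m.+1 -> 'I_n})
      \sum_(j : {ffun 'I_m.+1 -> 'I_n})
      \sum_(w : {ffun 'I_m.+1 -> 'I_k.+1}
           | [&& (\sum_a i a)%N == l, (\sum_a w a + \sum_a j a)%N == k,
                 [forall a, (i a <= j a)%N]
               & [forall a, (a != ord0) ==> (1 <= i a)%N]])
        (\prod_a ('C(n, (j a).+1)%:R * zbar1 n zeta (w a))) *:
          ((1 - 'X) ^+ i ord0 * (- 'X) ^+ (l - i ord0)).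
Proof.
have n_neq0 : n%:R != 0 :> R[i] by rewrite Num.Theory.pnatr_eq0 -lt0n.
by split; [exact: Gzt_binomial | exact: Gzt_zbar1].
Qed.
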